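(* Let $G$ be a group, let $(\Gamma,\psi)$ be a $G$-gain graph on $n$ vertices, and let $\alpha=\{C_0,C_1,\ldots,C_k\}$ be a $G$-GM partition of $V_\Gamma$, with associated matrix $Q_\alpha\in M_n(\mathbb{C}G)$ and associated switched gain graph $(\Gamma,\psi)^\alpha=(\Gamma^\alpha,\psi^\alpha)$. Then $$A_{(\Gamma^\alpha,\psi^\alpha)}=Q_\alpha\,A_{(\Gamma,\psi)}\,Q_\alpha .$$ In particular, $(\Gamma,\psi)$ and $(\Gamma,\psi)^\alpha$ are $G$-cospectral.
   Context: **Group algebra.** $G$ is an arbitrary group with unit $1_G$. $\mathbb{C}G$ is its group algebra (finite $\mathbb{C}$-linear combinations of elements of $G$) with involution $(\sum_x f_x x)^*=\sum_x \overline{f_{x^{-1}}}\,x$. $M_n(\mathbb{C}G)$ is the algebra of $n\times n$ matrices over $\mathbb{C}G$, with involution $(F^* )_{i,j}=(F_{j,i})^*$. **Gain graphs.** $\Gamma=(V_\Gamma,E_\Gamma)$ is a finite simple graph; $u\sim v$ means $u,v$ are adjacent. A $G$-gain graph $(\Gamma,\psi)$ consists of $\Gamma$ and a map $\psi$ from ordered pairs of adjacent vertices to $G$ with $\psi(u,v)=\psi(v,u)^{-1}$. Fixing an ordering $v_1,\dots,v_n$ of $V_\Gamma$, its adjacency matrix $A_{(\Gamma,\psi)}\in M_n(\mathbb{C}G)$ has $(i,j)$ entry $\psi(v_i,v_j)$ if $v_i\sim v_j$ and $0$ otherwise. **$G$-cospectrality.** $Tr(A)=\sum_{i}A_{i,i}\in\mathbb{C}G$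 for $A\in M_n(\mathbb{C}G)$. For $f=\sum_x a_x x\in\mathbb{C}G$, $\mu(f)$ is the class function on $G$ given by $\mu(f)(g)=\sum_{x\in[g]}a_x$, where $[g]$ is the conjugacy class of $g$. Matrices $A,B\in M_n(\mathbb{C}G)$ with $A^*=A$, $B^*=B$ are $G$-cospectral if $\mu(Tr(A^h))=\mu(Tr(B^h))$ for all $h\in\mathbb{N}$; two $G$-gain graphs are $G$-cospectral if their adjacency matrices are. **$G$-GM partition.** For a partition $\alpha=\{C_0,C_1,\dots,C_k\}$ of $V_\Gamma$ and $v\in V_\Gamma$, put $\Psi_i(v)=\sum_{w\in C_i,\,w\sim v}\psi(v,w)\in\mathbb{C}G$. $\alpha$ is a $G$-GM partition if: - for all $i,j\in\{1,\dots,k\}$ and all $v,v'\in C_i$, $\Psi_j(v)=\Psi_j(v')$; - for every $v\in C_0$ and every $i\in\{1,\dots,k\}$ there exist $g_1,g_2\in G\cup\{0\}\subset\mathbb{C}G$ such that $\Psi_i(v)=\frac{|C_i|}{2}g_1+\frac{|C_i|}{2}g_2$. **Switched graph.** $(\Gamma,\psi)^\alpha=(\Gamma^\alpha,\psi^\alpha)$ is the $G$-gain graph on the same vertex set such that: adjacencies and gains between pairs of vertices of $\bigcup_{i=1}^k C_i$, and between pairs of vertices of $C_0$, are the same as in $(\Gamma,\psi)$; for $v\in C_0$, $i\in\{1,\dots,k\}$ with $\Psi_i(v)=\frac{|C_i|}{2}g_1+\frac{|C_i|}{2}g_2$, $g_1,g_2\in G\cup\{0\}$, and $w\in C_i$,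 one sets $\psi^\alpha(v,w)=g_1$ if $\psi(v,w)=g_2$ and $\psi^\alpha(v,w)=g_2$ if $\psi(v,w)=g_1$ (and $\psi^\alpha(w,v)=\psi^\alpha(v,w)^{-1}$), with the convention that the value $0$ means the two vertices are not adjacent. The same vertex ordering is used for both adjacency matrices. **Matrix $Q_\alpha$.** With $n_i=|C_i|$, $Q_\alpha\in M_n(\mathbb{C}G)$ is indexed by $V_\Gamma$ with entries $(Q_\alpha)_{u,v}=1_G$ if $u=v\in C_0$; $\frac{2-n_i}{n_i}1_G$ if $u=v\in C_i$, $i\ge1$; $\frac{2}{n_i}1_G$ if $u\neq v$, $u,v\in C_i$, $i\ge 1$; and $0$ otherwise. *)

(* Defs.v *)
(* Mathematical Components *)
From HB Require Import structures.
From mathcomp Require Import all_boot all_order all_algebra.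
From mathcomp Require Import finmap boolp reals complex.
From mathcomp.multinomials Require Import monalg.

Set Implicit Arguments.
Unset Strict Implicit.
Unset Printing Implicit Defensive.

Import Order.TTheory GRing.Theory Num.Theory.
Local Open Scope ring_scope.

(* [{malg C[G]}] is the module of finitely supported functions from [G] to
   [C]; its library ring structure excludes groups (it needs a monoid without
   nontrivial units), so the alias [galg C G] carries the convolution product. *)
Definition galg (C : nzRingType) (G : groupType) : Type := {malg C[G]}.

Section GroupAlgebraRing.
Variables (C : nzRingType) (G : groupType).

HB.instance Definition _ := GRing.Lmodule.on (galg C G).

Implicit Types f : galg C G.

Definition galg_one : galg C G := << 1%g >>.

Definition galg_mul f1 f2 : galg C G :=
  \sum_(x <- msupp f1) \sum_(y <- msupp f2) << f1@_x * f2@_y *g (x * y)%g >>.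

Lemma galg_mulEw (d1 d2 : {fset G}) f1 f2 :
    (msupp f1 `<=` d1)%fset -> (msupp f2 `<=` d2)%fset ->
  galg_mul f1 f2 =
    \sum_(x <- d1) \sum_(y <- d2) << f1@_x * f2@_y *g (x * y)%g >>.
Proof.
move=> le1 le2; rewrite /galg_mul (big_fset_incl _ le1) /=.
  apply: eq_bigr => x _; apply: big_fset_incl => // y _ /mcoeff_outdom ->.
  by rewrite mulr0 monalgU0.
move=> x _ /mcoeff_outdom fx0.
by rewrite big1 // => y _; rewrite fx0 mul0r monalgU0.
Qed.

Lemma galg_mul0l : left_zero 0 galg_mul.
Proof. by move=> f; rewrite /galg_mul msupp0 big_seq_fset0. Qed.

Lemma galg_mul0r : right_zero 0 galg_mul.
Proof.
by move=> f; rewrite /galg_mul big1 // => x _; rewrite msupp0 big_seq_fset0.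
Qed.

Lemma galg_mulUU c1 c2 x y :
  galg_mul << c1 *g x >> << c2 *g y >> = << c1 * c2 *g (x * y)%g >>.
Proof. by rewrite (galg_mulEw msuppU_le msuppU_le) !big_seq_fset1 !mcoeffUU. Qed.

Lemma galg_mulDl : left_distributive galg_mul +%R.
Proof.
move=> f1 f2 f; have le := fsubset_refl (msupp f).
rewrite (galg_mulEw (msuppD_le _ _) le) (galg_mulEw (fsubsetUl _ (msupp f2)) le).
rewrite (galg_mulEw (fsubsetUr (msupp f1) _) le) -big_split /=.
apply: eq_bigr => x _; rewrite -big_split /=; apply: eq_bigr => y _.
by rewrite mcoeffD mulrDl monalgUD.
Qed.

Lemma galg_mulDr : right_distributive galg_mul +%R.
Proof.
move=> f f1 f2; have le := fsubset_refl (msupp f).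
rewrite (galg_mulEw le (msuppD_le _ _)) (galg_mulEw le (fsubsetUl _ (msupp f2))).
rewrite (galg_mulEw le (fsubsetUr (msupp f1) _)) -big_split /=.
apply: eq_bigr => x _; rewrite -big_split /=; apply: eq_bigr => y _.
by rewrite mcoeffD mulrDr monalgUD.
Qed.

Lemma galg_ind (K : galg C G -> Prop) :
    K 0 -> (forall f1 f2, K f1 -> K f2 -> K (f1 + f2)) ->
    (forall c x, K << c *g x >>) -> forall f, K f.
Proof. by move=> K0 KD KU f; rewrite (monalgE f); apply: big_ind. Qed.

Lemma galg_mul1l : left_id galg_one galg_mul.
Proof.
elim/galg_ind => [|f1 f2 IH1 IH2|c x]; first exact: galg_mul0r.
  by rewrite galg_mulDr IH1 IH2.
by rewrite galg_mulUU mul1r mul1g.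
Qed.

Lemma galg_mul1r : right_id galg_one galg_mul.
Proof.
elim/galg_ind => [|f1 f2 IH1 IH2|c x]; first exact: galg_mul0l.
  by rewrite galg_mulDl IH1 IH2.
by rewrite galg_mulUU mulr1 mulg1.
Qed.

Lemma galg_mulA : associative galg_mul.
Proof.
move=> f1 f2 f3; elim/galg_ind: f1 => [|f f' IH IH'|c x].
- by rewrite !galg_mul0l.
- by rewrite !galg_mulDl IH IH'.
elim/galg_ind: f2 => [|f f' IH IH'|c' y].
- by rewrite galg_mul0l !galg_mul0r galg_mul0l.
- by rewrite galg_mulDl !galg_mulDr galg_mulDl IH IH'.
elim/galg_ind: f3 => [|f f' IH IH'|c'' z].
- by rewrite !galg_mul0r.
- by rewrite !galg_mulDr IH IH'.
by rewrite !galg_mulUU mulrA mulgA.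
Qed.

Lemma galg_one_neq0 : galg_one != 0.
Proof. by rewrite monalgU_eq0 oner_eq0. Qed.

HB.instance Definition _ := GRing.Zmodule_isNzRing.Build (galg C G)
  galg_mulA galg_mul1l galg_mul1r galg_mulDl galg_mulDr galg_one_neq0.

End GroupAlgebraRing.

Section GroupAlgebra.
Variables (C : numClosedFieldType) (G : groupType).
Implicit Types f : galg C G.

Definition galg_star f : galg C G :=
  \sum_(x <- msupp f) << (f@_x)^* *g (x^-1)%g >>.

Lemma galg_starE f x : (galg_star f)@_x = (f@_(x^-1)%g)^*.
Proof.
rewrite /galg_star raddf_sum /=.
transitivity (\sum_(y <- msupp f | y == x^-1%g) (f@_y)^*).
  rewrite [RHS]big_mkcond; apply: eq_bigr => y _.
  by rewrite mcoeffU -(inj_eq (@invg_inj G)) invgK; case: eqP.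
case: (msuppP f x^-1%g) => [xf|xf].
  rewrite big_mkcond (big_fsetD1 _ xf) /= eqxx big1_fset ?addr0 // => y.
  by rewrite !inE => /andP[/negPf->].
rewrite big1_seq ?conjC0 // => y /andP[/eqP-> xf'].
by rewrite xf' in xf.
Qed.

(* The map $\mu$: the conjugacy class of [g] may be infinite, but only finitely
   many of its elements are in the support of [f]. *)
Definition class_sum f (g : G) : C :=
  \sum_(x <- msupp f | `[< exists h : G, x = (g ^ h)%g >]) f@_x.

Definition mx_star n (A : 'M[galg C G]_n) : 'M[galg C G]_n :=
  \matrix_(i, j) galg_star (A j i).

Definition cospectral n (A B : 'M[galg C G]_n) : Prop :=
  [/\ mx_star A = A, mx_star B = B
    & forall h : nat, class_sum (\tr (A ^+ h)) =1 class_sum (\tr (B ^+ h))].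

(* [option G] stands for $G \cup \{0\}$, with [None] standing for $0$. *)
Definition of_option (o : option G) : galg C G :=
  if o is Some g then << g >> else 0.

End GroupAlgebra.

Record sgraph (V : finType) := SGraph {
  adj : rel V;
  adj_sym : symmetric adj;
  adj_irrefl : irreflexive adj
}.

(* Only the values of [gain] at adjacent pairs are meaningful; [gain0] below
   extends them by $0$. *)
Record gain_graph (G : groupType) (V : finType) := GainGraph {
  graph_of : sgraph V;
  gain : V -> V -> G;
  gainV : forall u v, adj graph_of u v -> gain u v = ((gain v u)^-1)%g
}.

Section GainGraphs.
Variables (G : groupType) (V : finType).
Implicit Types (Gam : gain_graph G V).

Definition gain0 Gam u v : option G :=
  if adj (graph_of Gam) u v then Some (gain Gam u v) else None.

Lemma gain0V Gam u v : gain0 Gam u v = omap (fun g => g^-1)%g (gain0 Gam v u).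
Proof.
by rewrite /gain0 adj_sym; case: ifP => //= uv; rewrite gainV // adj_sym.
Qed.

Lemma gain0_irrefl Gam v : gain0 Gam v v = None.
Proof. by rewrite /gain0 adj_irrefl. Qed.

Section OfOption.
Variable psi : V -> V -> option G.
Hypothesis psiV : forall u v, psi u v = omap (fun g => g^-1)%g (psi v u).
Hypothesis psi_irrefl : forall v, psi v v = None.

Let adj_of u v := psi u v != None.

Let adj_of_sym : symmetric adj_of.
Proof. by move=> u v; rewrite /adj_of psiV; case: (psi v u). Qed.

Let adj_of_irrefl : irreflexive adj_of.
Proof. by move=> v; rewrite /adj_of psi_irrefl. Qed.

Let gain_of u v := odflt 1%g (psi u v).

Let gain_ofV u v : adj_of u v -> gain_of u v = ((gain_of v u)^-1)%g.
Proof. by rewrite /adj_of /gain_of psiV; case: (psi v u). Qed.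

Definition gain_graph_of : gain_graph G V :=
  @GainGraph G V (SGraph adj_of_sym adj_of_irrefl) gain_of gain_ofV.

Lemma gain0_of u v : gain0 gain_graph_of u v = psi u v.
Proof. by rewrite /gain0 /= /adj_of /gain_of; case: (psi u v). Qed.

End OfOption.

Variable C : numClosedFieldType.

Definition adjmx n (v : 'I_n -> V) Gam : 'M[galg C G]_n :=
  \matrix_(i, j) of_option C (gain0 Gam (v i) (v j)).

Definition Psi Gam (A : {set V}) (v : V) : galg C G :=
  \sum_(w in A | adj (graph_of Gam) v w) << gain Gam v w >>.

Definition half_split Gam (A : {set V}) (v : V) (p : option G * option G) : bool :=
  Psi Gam A v == (#|A|%:R / 2) *: of_option C p.1 + (#|A|%:R / 2) *: of_option C p.2.

Section Switching.
Variables (Gam : gain_graph G V) (k : nat) (P : 'I_k.+1 -> {set V}).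

Definition indexed_partition : Prop :=
  injective P /\ partition [set P i | i : 'I_k.+1] [set: V].

Definition GM_partition : Prop :=
  [/\ indexed_partition,
      forall i j, i != ord0 -> j != ord0 ->
        {in P i &, forall v v', Psi Gam (P j) v = Psi Gam (P j) v'}
    & {in P ord0, forall v i, i != ord0 ->
        exists g1 g2 : option G, half_split Gam (P i) v (g1, g2)}].

(* The pair $(g_1, g_2)$ is unique up to order when [A] is nonempty, and
   exchanging its components does not change [exchange] (see [switchP]). *)
Definition the_split (A : {set V}) (v : V) : option G * option G :=
  if pselect (exists p, half_split Gam A v p) is left e then xchoose e
  else (None, None).

Definition exchange (p : option G * option G) (o : option G) : option G :=
  if o == p.1 then p.2 else if o == p.2 then p.1 else o.

Definition switch_gain_from (v w : V) : option G :=
  if [pick i | (i != ord0) && (w \in P i)] is Some i then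
    exchange (the_split (P i) v) (gain0 Gam v w)
  else gain0 Gam v w.

Definition switch_gain (u w : V) : option G :=
  match u \in P ord0, w \in P ord0 with
  | true, false => switch_gain_from u w
  | false, true => omap (fun g => g^-1)%g (switch_gain_from w u)
  | _, _ => gain0 Gam u w
  end.

Lemma switch_gainV u w :
  switch_gain u w = omap (fun g => g^-1)%g (switch_gain w u).
Proof.
rewrite /switch_gain; case: (u \in _); case: (w \in _) => //;
  try exact: gain0V.
by case: (switch_gain_from u w) => //= g; rewrite invgK.
Qed.

Lemma switch_gain_irrefl v : switch_gain v v = None.
Proof. by rewrite /switch_gain; case: (v \in _); exact: gain0_irrefl. Qed.

Definition switch : gain_graph G V :=
  gain_graph_of switch_gainV switch_gain_irrefl.

Lemma of_optionE (o : option G) g : (of_option C o)@_g = (o == Some g)%:R.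
Proof. by case: o => [h|] /=; rewrite ?mcoeffU ?mcoeff0. Qed.

Lemma half_split_uniq A v p q : A != set0 ->
  half_split Gam A v p -> half_split Gam A v q -> q = p \/ q = (p.2, p.1).
Proof.
rewrite -card_gt0 /half_split => A0 /eqP-> /eqP; rewrite -!scalerDr => /scalerI.
have /[swap]/[apply]: (#|A|%:R / 2 : C) != 0.
  by rewrite mulf_neq0 ?invr_eq0 ?pnatr_eq0 // -lt0n.
case: p q => [p1 p2] [q1 q2] /= E.
have {}E g :
    ((p1 == Some g) + (p2 == Some g) = (q1 == Some g) + (q2 == Some g))%N.
  apply/eqP; rewrite -(eqr_nat C) !natrD -!of_optionE.
  by rewrite -!mcoeffD E.
have cancel_opt (o o' : option G) :
    (forall g, (o == Some g) = (o' == Some g) :> nat) -> o = o'.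
  case: o o' => [a|] [b|] // eq_o; [move: (eq_o a)|move: (eq_o a)|move: (eq_o b)];
    by rewrite ?eqxx //= eq_sym; case: eqP => [->|].
have [p1q1|p1q1] := eqVneq p1 q1.
  left; congr (_, _) => //; apply: cancel_opt => g.
  by have := E g; rewrite p1q1 => /addnI.
have [p1q2|p1q2] := eqVneq p1 q2.
  right; congr (_, _) => //; apply: cancel_opt => g.
  by have := E g; rewrite p1q2 addnC => /addIn.
case: p1 p1q1 p1q2 E => [a|] + + E.
  rewrite eq_sym => /negPf aq1; rewrite eq_sym => /negPf aq2.
  by have := E a; rewrite eqxx aq1 aq2.
case: q1 q2 E => [c|] [d|] // E _ _.
have := E c; have := E d; rewrite !eqxx /=.
by case: p2 {E} => [x|] //=; do !case: eqP => //; congruence.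
Qed.

Lemma exchange_sym (p : option G * option G) o :
  exchange (p.2, p.1) o = exchange p o.
Proof.
rewrite /exchange /=.
by have [->|_] := eqVneq o p.2; [have [<-|_] := eqVneq p.2 p.1|].
Qed.

Lemma exchange1 p : exchange p p.1 = p.2.
Proof. by rewrite /exchange eqxx. Qed.

Lemma switchP v i w g1 g2 : indexed_partition ->
    v \in P ord0 -> i != ord0 -> w \in P i -> half_split Gam (P i) v (g1, g2) ->
  [/\ gain0 Gam v w = g1 -> gain0 switch v w = g2,
      gain0 Gam v w = g2 -> gain0 switch v w = g1
    & gain0 switch w v = omap (fun g => g^-1)%g (gain0 switch v w)].
Proof.
move=> [Pinj /and3P[_ /trivIsetP Ptriv _]] v0 i0 wi spl.
have disj j : j != i -> w \notin P j.
  move=> ji; apply/negP => wj.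
  have /Ptriv/(_ _) : P j \in [set P i | i : 'I_k.+1] by apply: imset_f.
  move=> /(_ (P i) (imset_f _ isT)); rewrite (inj_eq Pinj) => /(_ ji).
  by move=> /pred0P/(_ w); rewrite /= wj wi.
have E : gain0 switch v w = exchange (g1, g2) (gain0 Gam v w).
  rewrite gain0_of /switch_gain v0 (negPf (disj ord0 _)) 1?eq_sym //.
  rewrite /switch_gain_from; case: pickP => [j /andP[j0 wj]|/(_ i)]; last first.
    by rewrite i0 wi.
  have {j0 wj}-> : j = i by apply/eqP; apply: contraTT wj => /disj.
  rewrite /the_split; case: pselect => [e|[]]; last by exists (g1, g2).
  have Pi0 : P i != set0 by apply/set0Pn; exists w.
  by have [->|->] := half_split_uniq Pi0 spl (xchooseP e); rewrite // exchange_sym.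
split; last exact: gain0V.
  by rewrite E => ->; rewrite exchange1.
by rewrite E -exchange_sym => ->; rewrite exchange1.
Qed.

(* Entry at [(u, w)] of the matrix $Q_\alpha$ indexed by [V]. *)
Definition Q_entry (u w : V) : galg C G :=
  if u \in P ord0 then (if u == w then << 1%g >> else 0)
  else if [pick i | (u \in P i) && (w \in P i)] is Some i then
    (if u == w then << (2 - #|P i|%:R) / #|P i|%:R *g 1%g >>
     else << 2 / #|P i|%:R *g 1%g >>)
  else 0.

Definition Qmx n (v : 'I_n -> V) : 'M[galg C G]_n :=
  \matrix_(i, j) Q_entry (v i) (v j).

End Switching.
End GainGraphs.

(* Main.v *)
Require Import Defs.
From mathcomp Require Import all_boot all_order all_algebra.
From mathcomp Require Import finmap boolp reals complex.
From mathcomp.multinomials Require Import monalg.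
Import GRing.Theory Num.Theory.
Local Open Scope ring_scope.

Set Implicit Arguments.
Unset Strict Implicit.
Unset Printing Implicit Defensive.

(** Write $a(x,y)$ for the entries of the adjacency matrix $A$. On a block
    $C_i$ of size $n_i$ with $i\ge 1$, the matrix $Q_\alpha$ is
    $\frac{2}{n_i}J-I$, with $J$ the all-one matrix, and on $C_0$ it is the
    identity. So multiplying by $Q_\alpha$ replaces a function $F$ on the
    vertices by its mirror image [block_refl] through the functions that are
    constant on $C_1,\dots,C_k$: the value at $w\in C_i$ becomes twice the mean
    of $F$ over $C_i$ minus $F(w)$. In particular $Q_\alpha^2=1$.

    Compute $Q_\alpha A Q_\alpha$ block by block. Within $C_0$ nothing changes.
    For $u\in C_0$ and $w\in C_i$ the entry becomes
    $\frac{2}{n_i}\Psi_i(u)-a(u,w)=g_1+g_2-a(u,w)$. Every entry $a(u,w)$ with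
    $w\in C_i$ is one of $g_1,g_2$ ([half_split_gain0]): this is clear for gains
    in $G$, and if $g_1,g_2$ both lie in $G$ then the coefficients of
    $\Psi_i(u)$ add up to $n_i$, so $u$ is adjacent to all of $C_i$. Hence the new
    entry is the other one of $g_1,g_2$, which is the switched gain
    ([switch_row]). The block $C_i\times C_0$ follows by applying the
    involution ([switch_col]). For $u\in C_i$ and $w\in C_j$ with $i,j\ge1$ the
    row sums over $C_i\times C_j$ are constant, and so are the column sums;
    counting the block both ways shows that twice the mean of a row and twice
    the mean of a column agree, and the correction terms cancel
    ([refl_inner_block]).

    For cospectrality, $Q_\alpha^2=1$ gives $A'^h=Q_\alpha A^hQ_\alpha$, and as
    the entries of $Q_\alpha$ are scalars, $Q_\alpha$ can be moved cyclically
    inside the trace even though $\mathbb{C}G$ is not commutative. Therefore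
    already $Tr(A'^h)=Tr(A^h)$ in $\mathbb{C}G$. *)

(** * Scalars and the involution of the group algebra *)

Section GroupAlgebraFacts.
Variables (C : numClosedFieldType) (G : groupType).
Implicit Types (f : galg C G) (c : C) (o : option G).

Lemma scaleU c d (x : G) : c *: (<< d *g x >> : galg C G) = << c * d *g x >>.
Proof. by apply/malgP => y; rewrite mcoeffZ !mcoeffU mulrnAr. Qed.

Lemma scalar_mull c f : (<< c *g 1%g >> : galg C G) * f = c *: f.
Proof.
elim/galg_ind: f => [|f1 f2 IH1 IH2|d x]; first by rewrite mulr0 scaler0.
  by rewrite mulrDr scalerDr IH1 IH2.
by rewrite [LHS]galg_mulUU mul1g scaleU.
Qed.

Lemma scalar_mulr c f : f * (<< c *g 1%g >> : galg C G) = c *: f.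
Proof.
elim/galg_ind: f => [|f1 f2 IH1 IH2|d x]; first by rewrite mul0r scaler0.
  by rewrite mulrDl scalerDr IH1 IH2.
by rewrite [LHS]galg_mulUU mulg1 mulrC scaleU.
Qed.

Lemma galg_starB : {morph @galg_star C G : f1 f2 / f1 - f2}.
Proof.
by move=> f1 f2; apply/malgP => x; rewrite mcoeffB !galg_starE mcoeffB rmorphB.
Qed.

Lemma galg_starD : {morph @galg_star C G : f1 f2 / f1 + f2}.
Proof.
by move=> f1 f2; apply/malgP => x; rewrite mcoeffD !galg_starE mcoeffD rmorphD.
Qed.

Lemma galg_star0 : galg_star (0 : galg C G) = 0.
Proof. by apply/malgP => x; rewrite galg_starE !mcoeff0 rmorph0. Qed.

Lemma galg_star_sum (I : Type) (r : seq I) (p : pred I) (F : I -> galg C G) :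
  galg_star (\sum_(i <- r | p i) F i) = \sum_(i <- r | p i) galg_star (F i).
Proof. by apply: big_morph; [exact: galg_starD | exact: galg_star0]. Qed.

Lemma galg_starZ c f : galg_star (c *: f) = c^* *: galg_star f.
Proof.
by apply/malgP => x; rewrite mcoeffZ !galg_starE mcoeffZ rmorphM.
Qed.

Lemma galg_star_of_option o :
  galg_star (of_option C o) = of_option C (omap (fun g => g^-1)%g o).
Proof.
apply/malgP => x; rewrite galg_starE !of_optionE rmorph_nat.
case: o => //= g; congr (nat_of_bool _)%:R.
by apply/eqP/eqP => [[->]|[<-]]; rewrite invgK.
Qed.

Definition augmentation : galg C G -> C := mmap idfun (fun _ : G => 1).

Lemma augmentationD : {morph augmentation : f1 f2 / f1 + f2}.
Proof. exact: mmapD. Qed.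

Lemma augmentationZ c f : augmentation (c *: f) = c * augmentation f.
Proof.
elim/galg_ind: f => [|f1 f2 IH1 IH2|d x].
- by rewrite scaler0 /augmentation mmap0 mulr0.
- by rewrite scalerDr !augmentationD mulrDr IH1 IH2.
- by rewrite scaleU /augmentation !mmapU !mulr1.
Qed.

Lemma augmentation_sum (I : Type) (r : seq I) (p : pred I) (F : I -> galg C G) :
  augmentation (\sum_(i <- r | p i) F i) = \sum_(i <- r | p i) augmentation (F i).
Proof. by apply: big_morph; [exact: augmentationD | exact: mmap0]. Qed.

Lemma augmentation_of_option o : augmentation (of_option C o) = (o != None)%:R.
Proof. by case: o => [x|]; rewrite /augmentation ?mmap0 // mmapU mulr1. Qed.

End GroupAlgebraFacts.

(** * Rows of the adjacency matrix on a block *)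

Section Rows.
Variables (G : groupType) (V : finType) (C : numClosedFieldType).
Variable Gam : gain_graph G V.

Definition adj_entry (u w : V) : galg C G := of_option C (gain0 Gam u w).

Lemma Psi_sum (A : {set V}) u : Psi C Gam A u = \sum_(w in A) adj_entry u w.
Proof.
rewrite /Psi big_mkcondr; apply: eq_bigr => w _.
by rewrite /adj_entry /gain0; case: ifP.
Qed.

Lemma adj_entry_star u w : galg_star (adj_entry w u) = adj_entry u w.
Proof. by rewrite galg_star_of_option /adj_entry [gain0 Gam u w]gain0V. Qed.

(** The condition on $\Psi$ only counts gains in $G$. Comparing coefficients
    settles those gains; a vertex of [A] not adjacent to [u] is detected by
    comparing sums of coefficients. *)
Lemma half_split_gain0 (A : {set V}) u w p :
  half_split C Gam A u p -> w \in A ->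
  gain0 Gam u w = p.1 \/ gain0 Gam u w = p.2.
Proof.
rewrite /half_split Psi_sum => /eqP E wA; set o := gain0 Gam u w.
have nat_ge0 (b : bool) : 0 <= b%:R :> C by rewrite ler0n.
case Eo : o => [g|].
  (* The coefficient of g on the left is positive. *)
  have := congr1 (mcoeff g) E.
  rewrite raddf_sum /= (bigD1 w wA) /= mcoeffD !mcoeffZ !of_optionE.
  rewrite -/o Eo eqxx.
  case: eqP => [->|_]; first by left.
  case: eqP => [->|_]; first by right.
  rewrite !mulr0 addr0 => /eqP; rewrite paddr_eq0 ?oner_eq0 //.
  by apply: sumr_ge0 => x _; rewrite of_optionE.
case: p E => [[g1|] [g2|]] E; [|by right|by left|by left].
(* The augmentation of the right-hand side is |A|; that of the left-hand side
   is at most |A| - 1, because w contributes nothing. *)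
have := congr1 (@augmentation C G) E.
rewrite augmentationD !augmentationZ !augmentation_of_option !mulr1 -splitr.
rewrite augmentation_sum -sumr_const.
rewrite (bigD1 w wA) [RHS](bigD1 w wA) /= augmentation_of_option -/o Eo add0r.
have /[swap] -> : \sum_(x in A | x != w) augmentation (adj_entry u x)
    <= \sum_(x in A | x != w) (1 : C).
  by apply: ler_sum => x _; rewrite augmentation_of_option; case: eqP.
by rewrite gerDr ler10.
Qed.

End Rows.

(** * Reflection of functions through the blocks *)

Section Reflection.
Variables (C : numClosedFieldType) (V : finType) (k : nat).
Variable P : 'I_k.+1 -> {set V}.

(** Twice the mean over the block of [u] minus the value at [u]; the block
    $C_0$ is left alone, so this is the operator with matrix $Q_\alpha$. *)
Definition block_refl (T : lmodType C) (F : V -> T) (u : V) : T :=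
  if [pick i | (i != ord0) && (u \in P i)] is Some i then
    (2 / #|P i|%:R) *: (\sum_(x in P i) F x) - F u
  else F u.

Hypothesis P_part : Defs.indexed_partition P.

Lemma block_unique i j u : u \in P i -> u \in P j -> i = j.
Proof.
case: P_part => Pinj /and3P[_ /trivIsetP Ptriv _] ui uj.
apply/eqP; apply: contraT => ij.
have := Ptriv (P i) (P j) (imset_f _ isT) (imset_f _ isT).
by rewrite (inj_eq Pinj) => /(_ ij) /pred0P/(_ u); rewrite /= ui uj.
Qed.

Lemma block_exists u : exists i, u \in P i.
Proof.
case: P_part => _ /and3P[/eqP Pcov _ _].
have : u \in cover [set P i | i : 'I_k.+1] by rewrite Pcov inE.
by case/bigcupP => _ /imsetP[i _ ->] ui; exists i.
Qed.

Lemma block_card_neq0 i : #|P i|%:R != 0 :> C.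
Proof.
case: P_part => _ /and3P[_ _]; rewrite pnatr_eq0 cards_eq0.
by apply: contraNneq => <-; exact: imset_f.
Qed.

Section Values.
Variables (T : lmodType C) (F : V -> T).

Lemma block_refl0 u : u \in P ord0 -> block_refl F u = F u.
Proof.
move=> u0; rewrite /block_refl; case: pickP => // i /andP[i0 ui].
by rewrite (block_unique ui u0) eqxx in i0.
Qed.

Lemma block_reflE i u : i != ord0 -> u \in P i ->
  block_refl F u = (2 / #|P i|%:R) *: (\sum_(x in P i) F x) - F u.
Proof.
move=> i0 ui; rewrite /block_refl; case: pickP => [j /andP[_ uj]|/(_ i)].
  by rewrite (block_unique uj ui).
by rewrite i0 ui.
Qed.

(** A function and its mean have the same total over a block, and the
    reflection is twice the mean minus the function. *)
Lemma block_refl_sum i : i != ord0 ->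
  \sum_(x in P i) block_refl F x = \sum_(x in P i) F x.
Proof.
move=> i0; rewrite (eq_bigr _ (fun x => block_reflE i0)) sumrB.
rewrite sumr_const -scaler_nat scalerA mulrCA mulfV ?block_card_neq0 // mulr1.
by rewrite scaler_nat mulr2n addrK.
Qed.

End Values.

Lemma block_reflK (T : lmodType C) (F : V -> T) u :
  block_refl (block_refl F) u = F u.
Proof.
have [i ui] := block_exists u; have [i0|i0] := eqVneq i ord0.
  by rewrite i0 in ui; rewrite !block_refl0.
by rewrite !(block_reflE _ i0 ui) block_refl_sum // opprB addrCA subrr addr0.
Qed.

Variable G : groupType.

Lemma Q_entryC u w : Q_entry G C P u w = Q_entry G C P w u.
Proof.
rewrite /Q_entry [w == u]eq_sym; under eq_pick do rewrite andbC.
have [->|uw] := eqVneq u w; first by [].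
case: ifP => u0; case: ifP => w0 //; case: pickP => // i /andP[wi ui].
  by rewrite (block_unique ui u0) w0 in wi.
by rewrite (block_unique wi w0) u0 in ui.
Qed.

(** The rows of $Q_\alpha$ are the reflections of the unit vectors, so that
    $Q_\alpha$ acts on any function as [block_refl]. *)
Lemma Q_entry_sum u (F : V -> galg C G) :
  \sum_x Q_entry G C P u x * F x = block_refl F u.
Proof.
have [i ui] := block_exists u; have [i0|i0] := eqVneq i ord0.
  rewrite i0 in ui; rewrite block_refl0 // (bigD1 u) //= big1 ?addr0.
    by rewrite /Q_entry ui eqxx scalar_mull scale1r.
  by move=> x xu; rewrite /Q_entry ui eq_sym (negPf xu) mul0r.
have u0 : (u \in P ord0) = false.
  by apply: contraNF i0 => /(block_unique ui)->.
rewrite (block_reflE _ i0 ui) (bigID [in P i]) /=.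
rewrite [X in _ + X]big1 ?addr0; last first.
  move=> x xi; rewrite /Q_entry u0; case: pickP => [j /andP[uj xj]|_].
    by rewrite (block_unique ui uj) xj in xi.
  by rewrite mul0r.
rewrite (bigD1 u ui) [in RHS](bigD1 u ui) /= scalerDr scaler_sumr addrAC.
congr (_ + _).
  rewrite /Q_entry u0 eqxx; case: pickP => [j /andP[uj _]|/(_ i)].
    rewrite (block_unique uj ui) scalar_mull mulrBl mulfV.
      by rewrite scalerBl scale1r.
    exact: block_card_neq0.
  by rewrite ui.
apply: eq_bigr => x /andP[xi /negPf xu]; rewrite /Q_entry u0 eq_sym xu.
have {}xi : x \in P i by [].
case: pickP => [j /andP[uj _]|/(_ i)]; last by rewrite ui xi.
by rewrite (block_unique uj ui) scalar_mull.
Qed.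

(** The entries of $Q_\alpha$ are scalars, hence central. *)
Lemma Q_entry_comm u w (f : galg C G) :
  Q_entry G C P u w * f = f * Q_entry G C P u w.
Proof.
by rewrite /Q_entry; case: ifP => _; [|case: pickP => [i _|_]]; try case: ifP => _;
  rewrite ?scalar_mull ?scalar_mulr ?mul0r ?mulr0.
Qed.

End Reflection.

(** * Entries of the switched adjacency matrix *)

Section SwitchEntries.
Variables (C : numClosedFieldType) (G : groupType) (V : finType).
Variables (Gam : gain_graph G V) (k : nat) (P : 'I_k.+1 -> {set V}).
Hypothesis GM : GM_partition C Gam P.

Let a := adj_entry C Gam.
Let a' := adj_entry C (switch C Gam P).
Let P_part : Defs.indexed_partition P. Proof. by case: GM. Qed.

Lemma switch_same u w : (u \in P ord0) = (w \in P ord0) -> a' u w = a u w.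
Proof.
by rewrite /a' /a /adj_entry gain0_of /switch_gain => ->; case: (w \in _).
Qed.

(** Here the reflected value is $g_1+g_2-a(u,w)$, the other one of $g_1$ and
    $g_2$. *)
Lemma switch_row u w : u \in P ord0 -> a' u w = block_refl P (a u) w.
Proof.
move=> u0; have [i wi] := block_exists P_part w; have [i0|i0] := eqVneq i ord0.
  by rewrite i0 in wi; rewrite block_refl0 // switch_same // u0.
rewrite (block_reflE P_part _ i0 wi) -Psi_sum.
case: GM => _ _ /(_ u u0 i i0)[g1 [g2 spl]].
have [sw1 sw2 _] := switchP P_part u0 i0 wi spl.
have /eqP-> := spl; rewrite -scalerDr scalerA mulrA mulfVK ?block_card_neq0 //.
rewrite mulfV ?pnatr_eq0 // scale1r /a /a' /adj_entry.
case: (half_split_gain0 spl wi) => /= E.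
  by rewrite (sw1 E) E [X in X - _]addrC addrK.
by rewrite (sw2 E) E addrK.
Qed.

Lemma conj_block_coef i : (2 / #|P i|%:R : C)^* = 2 / #|P i|%:R.
Proof. by rewrite rmorphM fmorphV !rmorph_nat. Qed.

Lemma block_refl_star (F : V -> galg C G) u :
  galg_star (block_refl P F u) = block_refl P (fun x => galg_star (F x)) u.
Proof.
rewrite /block_refl; case: pickP => // i _.
by rewrite galg_starB galg_starZ galg_star_sum conj_block_coef.
Qed.

(** Apply the involution to [switch_row], as both adjacency matrices are
    self-adjoint and the coefficients of the reflection are real. *)
Lemma switch_col u w : w \in P ord0 -> a' u w = block_refl P (a^~ w) u.
Proof.
move=> w0; rewrite /a' -adj_entry_star -/a' switch_row // block_refl_star.
congr (block_refl P _ u); apply/funext => x; exact: adj_entry_star.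
Qed.

(** Both sides are $(2/(n_in_j))$ times the sum of all entries of the block
    $C_i\times C_j$, computed by rows and by columns. *)
Lemma mean_row_col i j u w : i != ord0 -> j != ord0 -> u \in P i -> w \in P j ->
  (2 / #|P i|%:R) *: (\sum_(x in P i) a x w)
    = (2 / #|P j|%:R) *: (\sum_(y in P j) a u y).
Proof.
case: GM => _ eqPsi _ i0 j0 ui wj.
have row x : x \in P i -> \sum_(y in P j) a x y = \sum_(y in P j) a u y.
  move=> xi; rewrite -!Psi_sum; exact: (eqPsi i j i0 j0 x u xi ui).
have aS x y : a x y = galg_star (a y x) by rewrite adj_entry_star.
have col y : y \in P j -> \sum_(x in P i) a x y = \sum_(x in P i) a x w.
  move=> yj; rewrite (eq_bigr _ (fun x _ => aS x y)) -galg_star_sum -Psi_sum.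
  rewrite [RHS](eq_bigr _ (fun x _ => aS x w)) -galg_star_sum -Psi_sum.
  by congr galg_star; exact: (eqPsi j i j0 i0 y w yj wj).
have : \sum_(x in P i) \sum_(y in P j) a x y
    = \sum_(y in P j) \sum_(x in P i) a x y by exact: exchange_big.
rewrite (eq_bigr _ row) [RHS](eq_bigr _ col) !sumr_const -2!scaler_nat => E.
have nj := block_card_neq0 C P_part j.
have -> : \sum_(x in P i) a x w
    = (#|P j|%:R^-1 * #|P i|%:R : C) *: \sum_(y in P j) a u y.
  by rewrite -scalerA E scalerA mulVf // scale1r.
by rewrite scalerA mulrA mulrAC divfK ?block_card_neq0.
Qed.

(** Reflecting the columns subtracts each entry from twice its column mean, and
    reflecting the rows then does the same along rows. The first step does not
    change row sums, as [mean_row_col] lets the column means be replaced by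
    row means, so the second step undoes it. *)
Lemma refl_inner_block i j u w : i != ord0 -> j != ord0 ->
  u \in P i -> w \in P j ->
  block_refl P (fun y => block_refl P (a^~ y) u) w = a u w.
Proof.
move=> i0 j0 ui wj; rewrite (block_reflE P_part _ j0 wj).
rewrite (block_reflE P_part _ i0 ui) (mean_row_col i0 j0 ui wj).
rewrite [X in _ *: X - _](_ : _ = \sum_(y in P j) a u y).
  by rewrite opprB addrCA subrr addr0.
rewrite -[RHS](block_refl_sum P_part (a u) j0); apply: eq_bigr => y yj.
rewrite (block_reflE P_part _ i0 ui) (block_reflE P_part _ j0 yj).
by rewrite (mean_row_col i0 j0 ui yj).
Qed.

Lemma switch_entry u w :
  a' u w = block_refl P (fun y => block_refl P (a^~ y) u) w.
Proof.
case: (boolP (u \in P ord0)) => u0.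
  rewrite switch_row //; congr (block_refl P _ w); apply/funext => y.
  by rewrite block_refl0.
case: (boolP (w \in P ord0)) => w0; first by rewrite block_refl0 // switch_col.
have [i ui] := block_exists P_part u; have [j wj] := block_exists P_part w.
have i0 : i != ord0 by apply: contraNneq u0 => <-.
have j0 : j != ord0 by apply: contraNneq w0 => <-.
by rewrite (refl_inner_block i0 j0 ui wj) switch_same // (negPf u0) (negPf w0).
Qed.

End SwitchEntries.

(** * Matrices *)

(** Over a noncommutative ring the trace is cyclic in a factor whose entries
    are central. *)
Lemma mxtrace_mul_central (T : pzRingType) n (Q M : 'M[T]_n) :
  (forall i j x, Q i j * x = x * Q i j) -> \tr (Q *m M) = \tr (M *m Q).
Proof.
move=> Qc; rewrite /mxtrace; under eq_bigr do rewrite mxE.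
under [RHS]eq_bigr do rewrite mxE.
rewrite exchange_big; apply: eq_bigr => i _; apply: eq_bigr => j _; exact: Qc.
Qed.

Lemma exprn_conj_invol (T : pzRingType) (q x : T) h :
  q * q = 1 -> (q * x * q) ^+ h = q * x ^+ h * q.
Proof.
move=> qq; elim: h => [|h IH]; first by rewrite !expr0 mulr1.
by rewrite !exprS IH -(mulrA (q * x)) -[q * _ * q]mulrA (mulrA q q) qq mul1r !mulrA.
Qed.

Section Matrices.
Variables (C : numClosedFieldType) (G : groupType) (V : finType).
Variables (n : nat) (v : 'I_n -> V).

Lemma mx_star_adjmx (Gam : gain_graph G V) :
  mx_star (adjmx C v Gam) = adjmx C v Gam.
Proof. by apply/matrixP => i j; rewrite !mxE; exact: adj_entry_star. Qed.

Hypothesis v_bij : bijective v.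
Variables (k : nat) (P : 'I_k.+1 -> {set V}).
Hypothesis P_part : Defs.indexed_partition P.

Let Q := Qmx G C P v.

Lemma Qmx_mull (f : V -> V -> galg C G) :
  Q *m (\matrix_(i, j) f (v i) (v j))
    = \matrix_(i, j) block_refl P (f^~ (v j)) (v i).
Proof.
apply/matrixP => i j; rewrite !mxE -(Q_entry_sum P_part).
rewrite (reindex v) /=; last exact: onW_bij.
by apply: eq_bigr => l _; rewrite !mxE.
Qed.

Lemma Qmx_mulr (f : V -> V -> galg C G) :
  (\matrix_(i, j) f (v i) (v j)) *m Q
    = \matrix_(i, j) block_refl P (f (v i)) (v j).
Proof.
apply/matrixP => i j; rewrite !mxE -(Q_entry_sum P_part).
rewrite (reindex v) /=; last exact: onW_bij.
by apply: eq_bigr => l _; rewrite !mxE Q_entryC // Q_entry_comm.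
Qed.

Lemma Qmx_sqr : Q *m Q = 1%:M.
Proof.
pose delta (u w : V) : galg C G := (u == w)%:R.
have delta1 : \matrix_(i, j) delta (v i) (v j) = 1%:M.
  by apply/matrixP => i j; rewrite !mxE /delta (inj_eq (bij_inj v_bij)).
rewrite -{2}[Q]mulmx1 -delta1 Qmx_mull.
rewrite (Qmx_mull (fun u w => block_refl P (delta^~ w) u)).
by apply/matrixP => i j; rewrite !mxE block_reflK.
Qed.

Lemma mxtrace_conj_Q (M : 'M[galg C G]_n) : \tr (Q *m M *m Q) = \tr M.
Proof.
rewrite -mulmxA mxtrace_mul_central; first by rewrite -mulmxA Qmx_sqr mulmx1.
by move=> i j f; rewrite mxE Q_entry_comm.
Qed.

Lemma expmx_conj_Q (M : 'M[galg C G]_n) h :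
  (Q *m M *m Q) ^+ h = Q *m (M ^+ h) *m Q.
Proof.
exact: exprn_conj_invol Qmx_sqr.
Qed.

End Matrices.

Theorem theorem3p6 (R : realType) (G : groupType) (V : finType)
    (n : nat) (v : 'I_n -> V) (v_bij : bijective v)
    (Gam : gain_graph G V) (k : nat) (alpha : 'I_k.+1 -> {set V})
    (alpha_GM : GM_partition R[i] Gam alpha) :
  let A := adjmx R[i] v Gam in
  let A' := adjmx R[i] v (switch R[i] Gam alpha) in
  let Q := Qmx G R[i] alpha v in
  A' = Q *m A *m Q /\ cospectral A A'.
Proof.
move=> A A' Q; have P_part : Defs.indexed_partition alpha by case: alpha_GM.
have A'E : A' = Q *m A *m Q.
  rewrite /A /adjmx (Qmx_mull v_bij P_part (adj_entry R[i] Gam)).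
  rewrite (Qmx_mulr v_bij P_part
    (fun u y => block_refl alpha ((adj_entry R[i] Gam)^~ y) u)).
  by apply/matrixP => i j; rewrite !mxE -switch_entry.
split; first exact: A'E.
split; first exact: mx_star_adjmx.
  exact: mx_star_adjmx.
by move=> h; rewrite A'E (expmx_conj_Q v_bij P_part) (mxtrace_conj_Q v_bij P_part).
Qed.
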